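(* Let $a_0,\dots,a_{N-1}$ be a list of nonzero natural numbers which are pairwise coprime. If $\mu,\nu$ are random probability measures which are a.s. supported in $\{a_0,\dots,a_{N-1}\}$ and for every integer $k\ge0$ the random moments $\mu_k=\int_{\mathbb{R}}x^k\,d\mu(x)$ and $\nu_k=\int_{\mathbb{R}}x^k\,d\nu(x)$ have the same distribution, then $\mu$ and $\nu$ have the same distribution.
   Context: A random probability measure is a random variable with values in the set $P(\mathbb{R})$ of Borel probability measures on $\mathbb{R}$, equipped with the $\sigma$-algebra generated by the maps $\mu\mapsto\mu(B)$, $B\subset\mathbb{R}$ Borel. *)

(* Defs.v *)
From HB Require Import structures.
From mathcomp Require Import all_boot all_order all_algebra.
From mathcomp Require Import all_classical all_reals all_analysis.
From mathcomp Require Import measurable_realfun giry.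

Set Implicit Arguments.
Unset Strict Implicit.
Unset Printing Implicit Defensive.

Import Order.TTheory GRing.Theory Num.Theory numFieldNormedType.Exports.

Local Open Scope classical_set_scope.
Local Open Scope ring_scope.

(* The sigma-algebra of pprobability R R is generated by the sets
   [set m | m B < r%:E] with B Borel and r in [0, 1], i.e., by the evaluation
   maps m |-> m B. *)
Notation random_measure P R := {RV P >-> pprobability R R}.

(* measure_eq compares the two laws on measurable sets only: Leibniz equality
   of measures would also constrain their values on nonmeasurable sets, which
   carry no meaning. *)
Definition same_distribution d1 d2 d (T1 : measurableType d1)
    (T2 : measurableType d2) (S : measurableType d) (R : realType)
    (P1 : probability T1 R) (P2 : probability T2 R)
    (X : {RV P1 >-> S}) (Y : {RV P2 >-> S}) : Prop :=
  measure_eq (distribution P1 X) (distribution P2 Y).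

Definition as_supported d (T : measurableType d) (R : realType)
    (P : probability T R) (mu : random_measure P R) (S : set R) : Prop :=
  {ae P, forall w, (mu w : probability R R) S = 1%E}.

(* The integral is total: where x ^+ k is not m-integrable, the value is an
   arbitrary convention. This never happens for m of bounded support. *)
Definition moment (R : realType) (k : nat) (m : pprobability R R) : R :=
  \int[(m : probability R R)]_(x in [set: R]) (x ^+ k).

Lemma measurable_moment (R : realType) (k : nat) :
  measurable_fun [set: pprobability R R] (@moment R k).
Proof.
have mid : measurable_fun setT (@id (pprobability R R)) by exact: measurable_id.
pose f (x : R) : \bar R := (x ^+ k)%:E.
have mf : measurable_fun [set: R] f.
  by apply/measurable_EFinP; exact: measurable_funX.
apply: (@measurableT_comp _ _ _ _ _ _ (@fine R) _
  (fun m : pprobability R R => \int[(m : probability R R)]_x f x)%E) => //.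
under eq_fun do rewrite integralE.
apply: emeasurable_funB;
  apply: (measurable_fun_integral_kernel (l := kprobability mid)) => //.
- by move=> U mU; exact: measurable_kernel.
- exact: measurable_funepos.
- by move=> U mU; exact: measurable_kernel.
- exact: measurable_funeneg.
Qed.

HB.instance Definition _ (R : realType) (k : nat) :=
  isMeasurableFun.Build _ _ _ _ (@moment R k) (measurable_moment k).

Definition random_moment d (T : measurableType d) (R : realType)
    (P : probability T R) (mu : random_measure P R) (k : nat) : {RV P >-> R} :=
  @moment R k \o mu.

(* Main.v *)
Require Import Defs.
From HB Require Import structures.
From mathcomp Require Import all_boot all_order all_algebra.
From mathcomp Require Import all_classical all_reals all_analysis.
From mathcomp Require Import measurable_realfun ring lra.

(* Write p_i for the random mass at a_i. The n-th moment of the random variable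
   mu_k = sum_i p_i a_i^k is a sum over words f of length n of
   (prod_j a_(f j))^k E[prod_j p_(f j)]. By coprimality the product
   prod_j a_(f j) determines f up to permutation, so letting k vary these
   moments determine all mixed moments of (p_i), hence those of all the masses
   mu(B). Bounded families with the same mixed moments have the same law:
   indicators of half-lines are bounded pointwise limits of polynomials on
   [0, 1]. *)

Set Implicit Arguments.
Unset Strict Implicit.
Unset Printing Implicit Defensive.

Import Order.TTheory GRing.Theory Num.Theory numFieldNormedType.Exports.

Local Open Scope classical_set_scope.
Local Open Scope ring_scope.

(** * Coprime products determine words; separation of exponential sums *)

Lemma logn_prod_seq (q : nat) (I : eqType) (F : I -> nat) (u : seq I) :
  (forall i, (0 < F i)%N) ->
  logn q (\prod_(i <- u) F i)%N = (\sum_(i <- u) logn q (F i))%N.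
Proof.
move=> F0; elim: u => [|i u IHu]; first by rewrite !big_nil logn1.
by rewrite !big_cons lognM ?IHu// big_seq prodn_cond_gt0.
Qed.

(** A prime factor of [a i] divides no other [a j], so its exponent in the product reveals how often
    [i] occurs. At most one index has value 1, and the equal lengths give its multiplicity. *)
Lemma coprime_prod_perm_eq (I : eqType) (a : I -> nat) (u v : seq I) :
  injective a -> (forall i, a i != 0)%N ->
  (forall i j, i != j -> coprime (a i) (a j)) ->
  size u = size v ->
  (\prod_(i <- u) a i = \prod_(i <- v) a i)%N -> perm_eq u v.
Proof.
move=> inja a_neq0 a_cop szuv produv.
have a_gt0 i : (0 < a i)%N by rewrite lt0n.
have count_gt1 i : a i != 1%N -> count_mem i u = count_mem i v.
  move=> ai1; have ai_gt1 : (1 < a i)%N by rewrite ltn_neqAle eq_sym ai1 a_gt0.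
  set q := pdiv (a i).
  have logq0 j : j != i -> logn q (a j) = 0%N.
    move=> ji; rewrite logn_coprime// (coprime_dvdl (pdiv_dvd _))//.
    by rewrite a_cop// eq_sym.
  have logq w :
      logn q (\prod_(j <- w) a j)%N = (count_mem i w * logn q (a i))%N.
    rewrite logn_prod_seq//; elim: w => [|j w IHw]; first by rewrite big_nil.
    rewrite big_cons IHw /= mulnDl; congr addn.
    by have [->|/logq0 ->] := eqVneq j i; rewrite ?mul1n.
  have : (0 < logn q (a i))%N.
    by rewrite logn_gt0 mem_primes pdiv_prime ?a_gt0 ?pdiv_dvd.
  by move=> /eqn_pmul2r eqM; apply/eqP; rewrite -eqM -!logq produv.
apply/allP => i _ /=; apply/eqP.
have [ai1|/count_gt1//] := eqVneq (a i) 1%N.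
have : perm_eq [seq j <- u | j != i] [seq j <- v | j != i].
  apply/allP => j _ /=; rewrite !count_filter; apply/eqP.
  have [->|ji] := eqVneq j i.
    by rewrite !(@eq_count _ _ pred0) ?count_pred0// => x /=; case: eqP.
  have E w : count [pred x | x == j & x != i] w = count_mem j w.
    by apply: eq_count => x /=; case: eqP => // ->.
  rewrite !E count_gt1//; apply: contra_neq ji => aj1.
  by apply: inja; rewrite aj1 ai1.
move=> /perm_size; rewrite !size_filter => cC; apply/eqP.
rewrite -(eqn_add2r (count (predC (pred1 i)) u)).
by rewrite count_predC cC count_predC szuv.
Qed.

(** A Vandermonde argument: by linearity powers may be replaced by any polynomial, and one vanishing
    at every value of [b] other than [b g] isolates the fiber. *)
Lemma sum_power_fiber_eq0 (R : idomainType) (F : finType) (b c : F -> R) :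
  (forall k, \sum_f c f * b f ^+ k = 0) ->
  forall g, \sum_(f | b f == b g) c f = 0.
Proof.
move=> sum0 g.
have sumQ (Q : {poly R}) : \sum_f c f * Q.[b f] = 0.
  under eq_bigr do rewrite horner_coef mulr_sumr.
  rewrite exchange_big big1//= => k _.
  rewrite (eq_bigr (fun f => Q`_k * (c f * b f ^+ k))) => [|f _].
    by rewrite -mulr_sumr sum0 mulr0.
  by rewrite mulrCA.
pose Q := \prod_(f | b f != b g) ('X - (b f)%:P).
have Qg : Q.[b g] != 0.
  rewrite horner_prod; apply/prodf_neq0 => f bfg.
  by rewrite hornerXsubC subr_eq0 eq_sym.
have := sumQ Q; rewrite (bigID (fun f => b f == b g))/=.
rewrite [X in _ + X]big1 => [|f bfg]; last first.
  by rewrite /Q (bigD1 f)//= hornerM hornerXsubC subrr mul0r mulr0.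
rewrite (eq_bigr (fun f => c f * Q.[b g])) => [|f /eqP -> //].
by rewrite addr0 -mulr_suml => /eqP; rewrite mulf_eq0 (negPf Qg) orbF => /eqP.
Qed.

(** * Measurable functions with values in the unit interval *)

(** Masses, indicators and their products all lie in this class, whose members are integrable for
    every probability. *)
Definition unit_fun d (T : measurableType d) (R : realType) (f : T -> R) :=
  measurable_fun [set: T] f /\ forall x, 0 <= f x <= 1.

Lemma unit_funM d (T : measurableType d) (R : realType) (f g : T -> R) :
  unit_fun f -> unit_fun g -> unit_fun (fun x => f x * g x).
Proof.
move=> [mf f01] [mg g01]; split; first exact: measurable_funM.
move=> x; have /andP[f0 f1] := f01 x; have /andP[g0 g1] := g01 x.
by rewrite mulr_ge0 ?mulr_ile1.
Qed.

Lemma unit_fun1 d (T : measurableType d) (R : realType) :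
  unit_fun (fun _ : T => 1 : R).
Proof. by split=> // x; rewrite ler01 lexx. Qed.

Lemma unit_funX d (T : measurableType d) (R : realType) (f : T -> R) n :
  unit_fun f -> unit_fun (fun x => f x ^+ n).
Proof.
move=> uf; elim: n => [|n IHn]; first exact: unit_fun1.
by under eq_fun do rewrite exprS; exact: unit_funM.
Qed.

Lemma unit_fun_prod d (T : measurableType d) (R : realType) (I : Type)
    (f : I -> T -> R) (s : seq I) :
  (forall i, unit_fun (f i)) -> unit_fun (fun x => \prod_(i <- s) f i x).
Proof.
move=> uf; elim: s => [|i s IHs].
  by under eq_fun do rewrite big_nil; exact: unit_fun1.
by under eq_fun do rewrite big_cons; exact: unit_funM.
Qed.

Lemma unit_fun_indic d (T : measurableType d) (R : realType) (A : set T) :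
  measurable A -> unit_fun (\1_A : T -> R).
Proof.
move=> mA; split; first exact: measurable_indic.
by move=> x; rewrite indicE; case: (x \in A); rewrite ?lexx ler01.
Qed.

Lemma unit_fun_integrable d (T : measurableType d) (R : realType)
    (P : probability T R) (f : T -> R) :
  unit_fun f -> P.-integrable setT (EFin \o f).
Proof.
move=> [mf f01]; apply: measurable_bounded_integrable => //.
  by rewrite (le_lt_trans (probability_le1 _ _)) ?ltry.
exists 1; split=> // M M1 x _ /=; have /andP[f0 f1] := f01 x.
by rewrite ger0_norm// (le_trans f1)// ltW.
Qed.

Lemma Rintegral_sum d (T : measurableType d) (R : realType)
    (mu : {measure set T -> \bar R}) (D : set T) (I : Type) (s : seq I)
    (c : I -> R) (f : I -> T -> R) :
  measurable D -> (forall i, mu.-integrable D (EFin \o f i)) ->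
  \int[mu]_(x in D) (\sum_(i <- s) c i * f i x) =
  \sum_(i <- s) c i * \int[mu]_(x in D) f i x.
Proof.
move=> mD intf; have intcf i : mu.-integrable D (fun x => (c i * f i x)%:E).
  by apply: eq_integrable (integrableZl mD (c i) (intf i)).
rewrite /Rintegral; under eq_integral do rewrite -sumEFin.
rewrite integral_sum// -sum_fine; last first.
  by move=> i _; exact: integrable_fin_num.
by apply: eq_bigr => i _; exact: RintegralZl.
Qed.

(** * Mixed moments from the moments of power sums *)

Section mixed_moments.
Context d (T : measurableType d) (R : realType) (P Q : probability T R).
Context (I : finType) (a : I -> nat) (p : I -> T -> R).
Hypotheses (a_inj : injective a) (a_neq0 : forall i, a i != 0%N)
  (a_cop : forall i j, i != j -> coprime (a i) (a j))
  (p01 : forall i, unit_fun (p i)).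
Hypothesis powers_eq : forall k n,
  \int[P]_x (\sum_i p i x * (a i)%:R ^+ k) ^+ n =
  \int[Q]_x (\sum_i p i x * (a i)%:R ^+ k) ^+ n.

Lemma mixed_moments_eq (u : seq I) :
  \int[P]_x (\prod_(i <- u) p i x) = \int[Q]_x (\prod_(i <- u) p i x).
Proof.
set n := size u.
(* For a word [f] of length [n], [c m f] is its mixed moment and [b f] the base of the exponential
   [b f ^+ k] that multiplies it in the [n]-th moment. *)
pose c (m : probability T R) (f : {ffun 'I_n -> I}) :=
  \int[m]_x (\prod_(j < n) p (f j) x).
pose b (f : {ffun 'I_n -> I}) : R := (\prod_(j < n) a (f j))%N%:R.
have pow (m : probability T R) k :
    \int[m]_x (\sum_i p i x * (a i)%:R ^+ k) ^+ n =
    \sum_f b f ^+ k * c m f.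
  rewrite -Rintegral_sum// => [|f]; last first.
    by apply: unit_fun_integrable; exact: unit_fun_prod.
  apply: eq_Rintegral => x _.
  rewrite -[in LHS](card_ord n) -prodr_const bigA_distr_bigA/=.
  apply: eq_bigr => f _.
  by rewrite big_split/= prodrXl mulrC /b natr_prod.
have sum0 k : \sum_f (c P f - c Q f) * b f ^+ k = 0.
  under eq_bigr do rewrite mulrC mulrBr.
  by rewrite sumrB -!pow powers_eq subrr.
have prodE (f : {ffun 'I_n -> I}) (S : comPzSemiRingType) (F : I -> S) :
  \prod_(j < n) F (f j) = \prod_(i <- codom f) F i.
  by rewrite codomE big_map big_enum.
have prodnE (f : {ffun 'I_n -> I}) (F : I -> nat) :
  (\prod_(j < n) F (f j) = \prod_(i <- codom f) F i)%N.
  by rewrite codomE big_map big_enum.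
have cE m f g : b f = b g -> c m f = c m g.
  move=> /eqP; rewrite /b eqr_nat !prodnE => /eqP bfg.
  apply: eq_Rintegral => x _; rewrite !(prodE _ _ (p ^~ x)).
  apply/perm_big/(coprime_prod_perm_eq a_inj a_neq0 a_cop) => //.
  by rewrite !size_codom.
pose g := [ffun j : 'I_n => tnth (in_tuple u) j].
have cg (m : probability T R) : \int[m]_x (\prod_(i <- u) p i x) = c m g.
  apply: eq_Rintegral => x _; rewrite big_tnth.
  by apply: eq_bigr => j _; rewrite ffunE.
have := sum_power_fiber_eq0 sum0 g.
(* All words in the fiber of [g] have the same mixed moment, so the fiber sum is a multiple of one
   difference; the multiplicity is nonzero since [g] itself lies in the fiber. *)
rewrite (eq_bigr (fun=> c P g - c Q g)) => [|f /eqP bfg]; last first.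
  by rewrite !(cE _ _ _ bfg).
rewrite !cg sumr_const => /eqP; rewrite mulrn_eq0 subr_eq0.
by case/orP=> [/eqP/card0_eq/(_ g)/negbT/negP[]|/eqP //]; exact: eqxx.
Qed.

End mixed_moments.

(** * Polynomial approximation of half-line indicators *)

Lemma bernoulli_ineq (R : realDomainType) (x : R) n :
  -1 <= x -> 1 + x *+ n <= (1 + x) ^+ n.
Proof.
move=> x1; elim: n => [|n IHn]; first by rewrite mulr0n addr0.
have x10 : 0 <= 1 + x by rewrite -lerBlDl sub0r.
rewrite exprS; apply: le_trans (ler_wpM2l x10 IHn).
rewrite -!(mulr_natr x) -natr1.
have : 0 <= x ^+ 2 * n%:R by rewrite mulr_ge0// sqr_ge0.
by lra.
Qed.

(* A steep polynomial on [0, 1]: for 0 <= y <= 1, (1 - y^m)^(2^m) tends to 1 as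
   m grows when 2y < 1 and to 0 when 2y > 1; the threshold is moved from 1/2
   slightly to the left of t, so that the value at t itself tends to 0. *)
Definition step_poly (R : realType) (t : R) (k : nat) : {poly R} :=
  let m := (k.+1 * k.+1)%N in
  (1 - (4^-1 *: 'X + (2^-1 - t / 4 + k.+1%:R^-1 / 4)%:P) ^+ m) ^+ (2 ^ m).

Lemma step_polyE (R : realType) (t : R) (k : nat) (x : R) :
  (step_poly t k).[x] =
  (1 - ((1 + (x - t) / 2 + k.+1%:R^-1 / 2) / 2) ^+ (k.+1 * k.+1))
  ^+ (2 ^ (k.+1 * k.+1)).
Proof.
rewrite /step_poly /= !hornerE /=; congr ((1 - _ ^+ _) ^+ _).
by field.
Qed.

(** With [w = y ^+ m] the value is [(1 - w) ^+ (2 ^ m)] and [z = 2 ^ m * w]. Bernoulli bounds it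
    below by [1 - z]; Bernoulli for [(1 + w) ^+ (2 ^ m)] and [(1 - w) * (1 + w) <= 1] give the
    product bound. *)
Lemma step_poly_bounds (R : realType) (t x : R) (k : nat) :
  0 <= t <= 1 -> 0 <= x <= 1 -> let m := (k.+1 * k.+1)%N in
  let z := (1 + (x - t) / 2 + k.+1%:R^-1 / 2) ^+ m in
  [/\ 0 <= (step_poly t k).[x], (step_poly t k).[x] <= 1,
      (step_poly t k).[x] * (1 + z) <= 1 & 1 - z <= (step_poly t k).[x] ].
Proof.
move=> t01 x01 m z; rewrite step_polyE -/m.
set e := k.+1%:R^-1 in z *.
have e0 : 0 <= e by rewrite invr_ge0 ler0n.
have e1 : e <= 1 by rewrite invf_le1 ?ltr0Sn// ler1n.
set y := (1 + _ + _) / 2; have y0 : 0 <= y by rewrite /y; lra.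
have y1 : y <= 1 by rewrite /y; lra.
have zE : z = y ^+ m *+ 2 ^ m.
  by rewrite /z /y expr_div_n -[RHS]mulr_natr natrX divfK ?expf_neq0 ?pnatr_eq0.
set w := y ^+ m in zE *.
have w0 : 0 <= w by exact: exprn_ge0.
have w1 : w <= 1 by exact: exprn_ile1.
split.
- by apply: exprn_ge0; rewrite subr_ge0.
- by apply: exprn_ile1; rewrite ?subr_ge0// gerBl.
- rewrite zE; apply: le_trans (_ : ((1 - w) * (1 + w)) ^+ (2 ^ m) <= _).
    rewrite exprMn ler_wpM2l ?exprn_ge0 ?subr_ge0//.
    by apply: bernoulli_ineq; lra.
  by apply: exprn_ile1; nra.
- rewrite zE -mulNrn; apply: bernoulli_ineq; lra.
Qed.

Lemma step_poly_cvg (R : realType) (t x : R) :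
  0 <= t <= 1 -> 0 <= x <= 1 ->
  (fun k => (step_poly t k).[x]) @ \oo --> ((x < t)%R%:R : R).
Proof.
move=> t01 x01; have [xt|tx] := ltP x t.
- apply: (@squeeze_cvgr _ _ _ _
    (fun k => 1 - (1 - (t - x) / 4) ^+ k) (fun=> 1)); last first.
  + exact: cvg_cst.
  + rewrite -[X in _ --> X](subr0 1); apply: cvgB; first exact: cvg_cst.
    by apply: cvg_expr; rewrite ger0_norm; lra.
  near=> k; have [_ -> _ zv] := step_poly_bounds k t01 x01; rewrite andbT.
  apply: le_trans zv; rewrite lerD2l lerN2.
  (* From here on the shift of the threshold uses up at most half of the gap, so the base of [z] is
     at most [1 - (t - x) / 4]. *)
  have ek : k.+1%:R^-1 < (t - x) / 2 :> R.
    near: k; apply: (@cvgr_lt R nat \oo _ harmonic 0 cvg_harmonic); lra.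
  have e0 : 0 <= k.+1%:R^-1 :> R by rewrite invr_ge0.
  set e := k.+1%:R^-1 in ek e0 *.
  apply: (@le_trans _ _ ((1 - (t - x) / 4) ^+ (k.+1 * k.+1))).
    by apply: lerXn2r; rewrite ?nnegrE; lra.
  by apply: ler_wiXn2l; [lra|lra|rewrite (leq_trans (leqnSn k))// leq_pmull].
- apply: (@squeeze_cvgr _ _ _ _
    (fun=> 0) (fun k => 2 * harmonic k)); last first.
  + by rewrite -[X in _ --> X](mulr0 2); apply: cvgMr; exact: cvg_harmonic.
  + exact: cvg_cst.
  near=> k; have [v0 _ + _] := step_poly_bounds k t01 x01; rewrite v0/=.
  set v := (step_poly t k).[x] in v0 *; set z := _ ^+ _ => vz.
  have e0 : 0 < k.+1%:R^-1 :> R by rewrite invr_gt0.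
  have eV : k.+1%:R^-1 * k.+1%:R = 1 :> R by rewrite mulVf.
  rewrite /= {}/z in vz *; set e := k.+1%:R^-1 in e0 eV vz *.
  set K : R := k.+1%:R in eV.
  (* The exponent is the square of [K] so that it outweighs the shift [e / 2]: Bernoulli yields
     [1 + K / 2], even at [x = t]. *)
  have zk : 1 + K / 2 <= (1 + (x - t) / 2 + e / 2) ^+ (k.+1 * k.+1).
    apply: (@le_trans _ _ (1 + (e / 2) *+ (k.+1 * k.+1))).
      rewrite -[X in _ <= _ + X]mulr_natr natrM -/K.
      by rewrite mulrACA eV mul1r mulrC.
    apply: le_trans (bernoulli_ineq _ _) _; first lra.
    by apply: lerXn2r; rewrite ?nnegrE; lra.
  have vK : v * K <= 2 by nra.
  by rewrite -ler_pdivrMr// /e invrK.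
Unshelve. all: by end_near.
Qed.

(** * Equality of laws for bounded families with equal moments *)

Lemma unit_fun_lt d (T : measurableType d) (R : realType) (X : T -> R) (t : R) :
  unit_fun X -> unit_fun (fun x => (X x < t)%R%:R : R).
Proof.
move=> [mX _].
rewrite (_ : (fun x => _) = \1_[set x | X x < t]); last first.
  by apply/funext => x; rewrite indicE mem_setE.
apply: unit_fun_indic; rewrite -[X in measurable X]setTI.
exact: (@measurable_fun_ltr _ _ _ _ X (cst t)).
Qed.

Lemma cvg_Rintegral_step_poly d (T : measurableType d) (R : realType)
    (P : probability T R) (W X : T -> R) (t : R) :
  unit_fun W -> unit_fun X -> 0 <= t <= 1 ->
  (fun k => \int[P]_x (W x * (step_poly t k).[X x])) @ \oo -->
  \int[P]_x (W x * (X x < t)%R%:R).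
Proof.
move=> uW uX t01.
have uS k : unit_fun (fun x => (step_poly t k).[X x]).
  split=> [|x].
    under eq_fun do rewrite step_polyE.
    apply: measurable_funX; apply: measurable_funB => //.
    apply: measurable_funX; apply: measurable_funM => //.
    apply: measurable_funD => //; apply: measurable_funD => //.
    apply: measurable_funM => //; apply: measurable_funB => //; exact: uX.1.
  by have [-> -> _ _] := step_poly_bounds k t01 (uX.2 x).
have uWS k := unit_funM uW (uS k).
have uWt := unit_funM uW (unit_fun_lt t uX).
have [|||||] := @dominated_convergence _ T R P setT measurableT
  (fun k x => (W x * (step_poly t k).[X x])%:E)
  (fun x => (W x * (X x < t)%R%:R)%:E) (cst 1%E).
- by move=> k; apply/measurable_EFinP; exact: (uWS k).1.
- by apply/measurable_EFinP; exact: uWt.1.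
- apply: aeW => x _; apply: cvg_EFin; first exact: nearW.
  by apply: cvgMr; exact: step_poly_cvg (uX.2 x).
- exact/finite_measure_integrable_cst.
- apply: aeW => x k _; rewrite lee_fin.
  by have /andP[w0 w1] := (uWS k).2 x; rewrite ger0_norm.
move=> _ _ cvgI; apply: fine_cvg; rewrite fineK//.
by apply: integrable_fin_num => //; exact: unit_fun_integrable.
Qed.

(** By linearity the two integrals agree for every polynomial in [X]; dominated convergence along
    [step_poly] passes this to the indicator. *)
Lemma lt_weighted_moments_eq d (T : measurableType d) (R : realType)
    (P Q : probability T R) (W X : T -> R) (t : R) :
  unit_fun W -> unit_fun X -> 0 <= t <= 1 ->
  (forall k, \int[P]_x (W x * X x ^+ k) = \int[Q]_x (W x * X x ^+ k)) ->
  \int[P]_x (W x * (X x < t)%R%:R) = \int[Q]_x (W x * (X x < t)%R%:R).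
Proof.
move=> uW uX t01 momE.
have polyE (m : probability T R) (q : {poly R}) :
    \int[m]_x (W x * q.[X x]) =
    \sum_(k < size q) q`_k * \int[m]_x (W x * X x ^+ k).
  rewrite -Rintegral_sum// => [|k]; last first.
    by apply: unit_fun_integrable; exact/unit_funM/unit_funX.
  apply: eq_Rintegral => x _; rewrite horner_coef mulr_sumr.
  by apply: eq_bigr => k _; rewrite mulrCA.
have := cvg_Rintegral_step_poly (P := P) uW uX t01.
rewrite (_ : (fun k => _) = fun k => \int[Q]_x (W x * (step_poly t k).[X x])).
  by move=> /cvg_unique; apply => //; exact: cvg_Rintegral_step_poly.
apply/funext => k; rewrite !polyE.
by apply: eq_bigr => j _; rewrite momE.
Qed.

Section unit_family.
Context d (T : measurableType d) (R : realType) (P Q : probability T R).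
Context (I : Type) (ev : I -> T -> R).
Hypothesis ev01 : forall i, unit_fun (ev i).
Hypothesis moments_eq : forall u : seq I,
  \int[P]_x (\prod_(i <- u) ev i x) = \int[Q]_x (\prod_(i <- u) ev i x).

(** Lists make intersection a concatenation, and the empty list gives the whole space. *)
Let below (s : seq (I * R)) := [set x | all (fun c => ev c.1 x < c.2) s].

Let unit_below s : unit_fun (\1_(below s) : T -> R).
Proof.
rewrite (_ : \1_ _ = fun x => \prod_(c <- s) (ev c.1 x < c.2)%R%:R).
  by apply: unit_fun_prod => c; exact: unit_fun_lt.
apply/funext => x; rewrite indicE mem_setE /=.
elim: s => [|c s IHs]; first by rewrite big_nil.
by rewrite big_cons /= -IHs -natrM mulnb.
Qed.

(* Monomials are replaced by indicators one coordinate at a time, the other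
   coordinates forming the weight of lt_weighted_moments_eq. *)
Let below_moments_eq s u : all (fun c => 0 <= c.2 <= 1) s ->
  \int[P]_x (\1_(below s) x * \prod_(i <- u) ev i x) =
  \int[Q]_x (\1_(below s) x * \prod_(i <- u) ev i x).
Proof.
elim: s u => [|[i t] s IHs] u /=.
  have E (m : probability T R) :
      \int[m]_x (\1_(below [::]) x * \prod_(i <- u) ev i x) =
      \int[m]_x (\prod_(i <- u) ev i x).
    by apply: eq_Rintegral => x _; rewrite indicE mem_setE mul1r.
  by rewrite !E.
move=> /andP[t01 s01].
pose W x : R := \1_(below s) x * \prod_(i <- u) ev i x.
have uW : unit_fun W.
  by apply: unit_funM; [exact: unit_below|exact: unit_fun_prod].
have E (m : probability T R) :
    \int[m]_x (\1_(below ((i, t) :: s)) x * \prod_(i <- u) ev i x) =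
    \int[m]_x (W x * (ev i x < t)%R%:R).
  apply: eq_Rintegral => x _; rewrite /W !indicE !mem_setE /= -mulnb natrM.
  by rewrite -mulrA mulrC.
rewrite !E; apply: lt_weighted_moments_eq => // k.
(* The power of [ev i] joins the monomial as [k] more letters, hence an induction hypothesis for all
   [u]. *)
have F (m : probability T R) : \int[m]_x (W x * ev i x ^+ k) =
    \int[m]_x (\1_(below s) x * \prod_(j <- u ++ nseq k i) ev j x).
  by apply: eq_Rintegral => x _; rewrite /W big_cat big_nseq iter_mulr_1 mulrA.
by rewrite !F IHs.
Qed.

(** The sets [below s] form a generating pi-system, on which the measures agree by the case of the
    empty monomial. *)
Lemma moments_measure_eq :
  @measurable _ T =
    <<s [set [set x | ev i x < r] | i in setT & r in `[0, 1]] >> ->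
  forall A, measurable A -> P A = Q A.
Proof.
move=> mE.
pose G : set (set T) :=
  [set A | exists2 s, all (fun c => 0 <= c.2 <= 1) s & A = below s].
have mbelow s : measurable (below s).
  by apply/(measurable_indicP R); exact: (unit_below s).1.
have mG : @measurable _ T = <<s G >>.
  apply/seteqP; split.
    rewrite mE; apply: smallest_sub; first exact: smallest_sigma_algebra.
    move=> _ [i _ [r r01 <-]]; apply: sub_sigma_algebra.
    exists [:: (i, r)]; first by move: r01; rewrite /= in_itv /= => ->.
    by apply/seteqP; split => x; rewrite /below /=; [move=> ->|case/andP].
  by apply: smallest_sub; [exact: sigma_algebra_measurable|move=> _ [s _ ->]].
apply: (measure_unique G (fun=> setT)) => //.
- move=> _ _ [s s01 ->] [s' s'01 ->]; exists (s ++ s').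
    by rewrite all_cat s01.
  by apply/seteqP; split => x; rewrite /below /= all_cat => /andP.
- by move=> _; exists [::] => //; apply/seteqP; split.
- by rewrite bigcup_const//; exists 0.
- move=> _ [s s01 ->].
  have E (m : probability T R) : m (below s) =
      (\int[m]_x (\1_(below s) x * \prod_(i <- [::]) ev i x))%:E.
    rewrite /Rintegral; under eq_integral do rewrite big_nil mulr1.
    by rewrite integral_indic// setIT fineK// fin_num_measure.
  by apply: etrans (E P) _; rewrite below_moments_eq//; apply: esym (E Q).


- by move=> _; rewrite (le_lt_trans (probability_le1 _ _))// ltry.
Qed.

End unit_family.

(** * Integrals against finitely supported measures *)

Lemma ae_eq_Rintegral d (T : measurableType d) (R : realType)
    (mu : {measure set T -> \bar R}) (f g : T -> R) :
  measurable_fun setT f -> measurable_fun setT g ->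
  {ae mu, forall x, f x = g x} -> \int[mu]_x f x = \int[mu]_x g x.
Proof.
move=> mf mg fg; congr fine; apply: ae_eq_integral => //.
- exact/measurable_EFinP.
- exact/measurable_EFinP.
- by apply: filterS fg => x -> .
Qed.

Lemma measurable_range_fin d (T : measurableType d) (I : finType) (b : I -> T) :
  (forall x : T, measurable [set x]) -> measurable (range b).
Proof.
move=> m1; apply: countable_measurable => //; apply: finite_set_countable.
exact: finite_image.
Qed.

Lemma Rintegral_fin_support (R : realType) (m : probability R R) (I : finType)
    (b : I -> R) (f : R -> R) :
  injective b -> measurable_fun setT f -> m (range b) = 1%E ->
  \int[m]_x f x = \sum_i f (b i) * fine (m [set b i]).
Proof.
move=> b_inj mf mb.
have mrb : measurable (range b) by exact: measurable_range_fin.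
have u1 i : unit_fun (\1_[set b i] : R -> R) by exact: unit_fun_indic.
(* Off the null complement of the support [f] equals this combination; injectivity of [b] leaves one
   nonzero indicator at each atom. *)
rewrite (@ae_eq_Rintegral _ _ _ _ _
  (fun x => \sum_i f (b i) * \1_[set b i] x))//.
- rewrite Rintegral_sum// => [|i]; last exact: unit_fun_integrable.
  by apply: eq_bigr => i _; rewrite /Rintegral integral_indic// setIT.
- by apply: measurable_sum => i; apply: measurable_funM => //; exact: (u1 i).1.
- exists (~` range b); split; first exact: measurableC.
    by apply: etrans (probability_setC m mrb) _; rewrite mb subee.
  move=> x /=; apply: contra_not => -[j _ <-].
  rewrite (bigD1 j)//= big1 => [|i ij].
    by rewrite indicE mem_set// mulr1 addr0.
  by rewrite indicE memNset ?mulr0// => /b_inj ji; rewrite ji eqxx in ij.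
Qed.

(** * Evaluation maps on the space of probability measures *)

Section evaluation.
Context (R : realType).
Let M := pprobability R R.

Definition ev (B : set R) (m : M) : R := fine ((m : probability R R) B).

Lemma unit_fun_ev (B : set R) : measurable B -> unit_fun (ev B).
Proof.
move=> mB; split=> [|m].
  apply: (@measurableT_comp _ _ _ _ _ _ (@fine R) _
    (fun m : M => (m : probability R R) B)) => //.
  have mid : measurable_fun setT (@id M) by exact: measurable_id.
  exact: (measurable_kernel (kprobability mid) _ mB).
by rewrite fine_ge0//= -lee_fin fineK ?fin_num_measure// probability_le1.
Qed.

(** This is the form required by [moments_measure_eq], with Borel sets as the indices of the
    coordinates. *)
Lemma pprobability_measurableE :
  @measurable _ M =
  <<s [set [set m | ev (sval B) m < r]
       | B in [set: {B : set R | measurable B}] & r in `[0, 1]] >>.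
Proof.
congr (<<s _ >>); apply/seteqP; split=> A.
- move=> [r r01] [B mB <-]; exists (exist _ B mB) => //; exists r => //.
  apply/seteqP; split=> m; rewrite /mset /ev /=.
    by rewrite -lte_fin fineK// fin_num_measure.
  by rewrite -lte_fin fineK// fin_num_measure.
- move=> [[B mB] _] [r r01 <-]; exists r => //; exists B => //.
  apply/seteqP; split=> m; rewrite /mset /ev /=.
    by rewrite -lte_fin fineK// fin_num_measure.
  by rewrite -lte_fin fineK// fin_num_measure.
Qed.

End evaluation.

(** * Laws on measures carried by finitely many atoms *)

Section finite_support.
Context (R : realType) (P Q : probability (pprobability R R) R).
Context (I : finType) (a : I -> nat).
Hypotheses (a_inj : injective a) (a_neq0 : forall i, a i != 0%N)
  (a_cop : forall i j, i != j -> coprime (a i) (a j)).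
Let b i : R := (a i)%:R.
Let supported (m : pprobability R R) := (m : probability R R) (range b) = 1%E.
Hypotheses
  (suppP : {ae P, forall m : pprobability R R, supported m})
  (suppQ : {ae Q, forall m : pprobability R R, supported m}).
Hypothesis moment_eq : forall k (A : set R), measurable A ->
  P (@moment R k @^-1` A) = Q (@moment R k @^-1` A).

Let p i := ev [set b i].

Let b_inj : injective b.
Proof. by move=> i j /eqP; rewrite eqr_nat => /eqP/a_inj. Qed.

Let unit_p i : unit_fun (p i).
Proof. exact: unit_fun_ev. Qed.

Let momentE (m : pprobability R R) k : supported m ->
  moment k m = \sum_i p i m * b i ^+ k.
Proof.
move=> mb; rewrite /moment (Rintegral_fin_support b_inj _ mb)//.
by apply: eq_bigr => i _; rewrite mulrC.
Qed.

(** This linear formula reduces the masses of arbitrary Borel sets to those of the atoms. *)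
Let evE (m : pprobability R R) B : measurable B ->
  supported m ->
  ev B m = \sum_i \1_B (b i) * p i m.
Proof.
move=> mB mb; rewrite -(Rintegral_fin_support b_inj (measurable_indic mB) mb).
by rewrite /Rintegral integral_indic// setIT.
Qed.

(* The moments are a.s. nonnegative; [`|y| ^+ n] makes the change of variables
   hold without an integrability condition. *)
Let powersE (L : probability (pprobability R R) R) k n :
  {ae L, forall m : pprobability R R, supported m} ->
  \int[L]_m (\sum_i p i m * b i ^+ k) ^+ n =
  \int[distribution L (@moment R k : {RV L >-> R})]_y `|y| ^+ n.
Proof.
move=> suppL.
have mX : measurable_fun [set: R] (fun y : R => `|y| ^+ n).
  by apply: measurable_funX; exact: normr_measurable.
rewrite [RHS]/Rintegral ge0_integral_distribution; last 2 first.
- exact/measurable_EFinP.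
- by move=> y; rewrite lee_fin exprn_ge0.
apply: ae_eq_Rintegral.
- apply: measurable_funX; apply: measurable_sum => i.
  by apply: measurable_funM => //; exact: (unit_p i).1.
- by apply: measurableT_comp mX _; exact: measurable_moment.
- apply: filterS suppL => m mb; rewrite /= (momentE k mb).
  rewrite ger0_norm// sumr_ge0// => i _.
  by rewrite mulr_ge0 ?exprn_ge0// ?ler0n//; case/andP: ((unit_p i).2 m).
Qed.

Let powers_eq k n :
  \int[P]_m (\sum_i p i m * b i ^+ k) ^+ n =
  \int[Q]_m (\sum_i p i m * b i ^+ k) ^+ n.
Proof.
rewrite !powersE//; congr fine; apply: eq_measure_integral => A mA _.
exact: moment_eq.
Qed.

Let Borel := {B : set R | measurable B}.

(** Induction on [s]: [evE] trades one Borel set for a sum over atoms [i], each of which lengthens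
    [u]; once [s] is empty, [mixed_moments_eq] applies. *)
Let ev_moments_eq (s : seq Borel) (u : seq I) :
  \int[P]_m (\prod_(B <- s) ev (sval B) m * \prod_(i <- u) p i m) =
  \int[Q]_m (\prod_(B <- s) ev (sval B) m * \prod_(i <- u) p i m).
Proof.
have uev (B : Borel) : unit_fun (ev (sval B)).
  exact: unit_fun_ev (svalP B).
elim: s u => [|B s IHs] u.
  have E (L : probability (pprobability R R) R) :
      \int[L]_m (\prod_(B <- [::] : seq Borel) ev (sval B) m *
        \prod_(i <- u) p i m) =
      \int[L]_m (\prod_(i <- u) p i m).
    by apply: eq_Rintegral => m _; rewrite big_nil mul1r.
  by rewrite !E (mixed_moments_eq a_inj a_neq0 a_cop unit_p powers_eq).
have E (L : probability (pprobability R R) R) :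
    {ae L, forall m : pprobability R R, supported m} ->
    \int[L]_m (\prod_(B' <- B :: s) ev (sval B') m * \prod_(i <- u) p i m) =
    \sum_i \1_(sval B) (b i) *
      \int[L]_m (\prod_(B' <- s) ev (sval B') m * \prod_(j <- i :: u) p j m).
  move=> suppL.
  have uf i : unit_fun (fun m =>
      \prod_(B' <- s) ev (sval B') m * \prod_(j <- i :: u) p j m).
    by apply: unit_funM; exact: unit_fun_prod.
  rewrite -Rintegral_sum// => [|i]; last exact: unit_fun_integrable.
  apply: ae_eq_Rintegral.
  - by apply: (unit_funM _ _).1; exact: unit_fun_prod.
  - apply: measurable_sum => i.
    by apply: measurable_funM => //; exact: (uf i).1.
  - apply: filterS suppL => m mb.
    rewrite big_cons (evE (svalP B) mb) !mulr_suml; apply: eq_bigr => i _.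
    by rewrite big_cons; ring.
by rewrite !E//; apply: eq_bigr => i _; rewrite IHs.
Qed.

Lemma fin_support_moments_measure_eq A : measurable A -> P A = Q A.
Proof.
apply: (moments_measure_eq (ev := fun B : Borel => ev (sval B))).
- by move=> B; exact: unit_fun_ev (svalP B).
- move=> s; have := ev_moments_eq s [::].
  by under eq_Rintegral do rewrite big_nil mulr1;
     under [in RHS]eq_Rintegral do rewrite big_nil mulr1.
- exact: pprobability_measurableE.
Qed.

End finite_support.

(** * Passage from random measures to their laws *)

Lemma as_supported_distribution d (T : measurableType d) (R : realType)
    (P : probability T R) (mu : random_measure P R) (S : set R) :
  measurable S -> as_supported mu S ->
  {ae distribution P mu,
    forall m : pprobability R R, (m : probability R R) S = 1%E}.
Proof.
move=> mS muS.
(* Measurability of [ev S] makes the exceptional set measurable, so its mass under the law is the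
   [P]-mass of its preimage. *)
pose N : set (pprobability R R) := ~` [set m | ev S m = 1].
have mN : measurable N.
  apply: measurableC; rewrite -[X in measurable X]setTI.
  exact: ((unit_fun_ev mS).1 measurableT [set 1]).
have evS (m : pprobability R R) : ev S m = 1 <-> (m : probability R R) S = 1%E.
  rewrite /ev; split=> [m1|-> //].
  by rewrite -[LHS]fineK ?m1// fin_num_measure.
exists N; split => //; last by move=> m /=; apply: contra_not => /evS.
apply: (measure_negligible (mu := P) (A := mu @^-1` N)).
  by rewrite -[X in measurable X]setTI; exact: measurable_funPT.
by apply: negligibleS muS => w /=; apply: contra_not => /evS.
Qed.

Unset Implicit Arguments.

Theorem theorem4p3p1 (R : realType) (N : nat) (a : 'I_N -> nat)
  (a_neq0 : forall i, a i != 0%N)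
  (a_coprime : forall i j, i != j -> coprime (a i) (a j))
  (d1 d2 : measure_display) (T1 : measurableType d1) (T2 : measurableType d2)
  (P1 : probability T1 R) (P2 : probability T2 R)
  (mu : random_measure P1 R) (nu : random_measure P2 R)
  (mu_supp : as_supported mu (range (fun i => (a i)%:R)))
  (nu_supp : as_supported nu (range (fun i => (a i)%:R)))
  (eq_moments : forall k : nat,
    same_distribution (random_moment mu k) (random_moment nu k)) :
  same_distribution mu nu.
Proof.
(* The a i may repeat the value 1, hence the indexing by distinct values. *)
have vala (i : seq_sub (codom a)) : exists j, ssval i = a j.
  by have /codomP[j] := ssvalP i; exists j.
pose b (i : seq_sub (codom a)) : R := (ssval i)%:R.
have rangeb : range b = range (fun i => (a i)%:R).
  apply/seteqP; split=> [_ [i _ <-]|_ [j _ <-]].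
    by have [j aj] := vala i; exists j => //; rewrite /b aj.
  by exists (SeqSub (codom_f a j)).
have mS : measurable (range (fun i => (a i)%:R : R)).
  exact: measurable_range_fin.
move=> A mA.
(* Applied to the laws of [mu] and [nu]: the law of [random_moment mu k] is the image of the law of
   [mu] under [moment k], so [eq_moments] supplies the moment hypothesis. *)
apply: (@fin_support_moments_measure_eq R _ _
  (seq_sub (codom a)) (@ssval _ _)) => //.
- exact: val_inj.
- by move=> i; have [j ->] := vala i.
- move=> i j ij; have [k ik] := vala i; have [l jl] := vala j.
  rewrite ik jl a_coprime//; apply: contra_neq ij => kl.
  by apply: val_inj; rewrite /= ik jl kl.
- by have := as_supported_distribution mS mu_supp; rewrite -rangeb.
- by have := as_supported_distribution mS nu_supp; rewrite -rangeb.
Qed.
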